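(* Let $k\in\mathbb{R}$, let $(X,d)$ be a complete $\mathrm{CAT}(k)$ space and $P$ a bounded subset of $X$ of diameter less than $D_k/4$. Let $u:P\to\mathbb{R}$ be a non-negative bounded function, not identically $0$. Let $\lambda>0$ and set $u'=\lambda u$. Then $r_{u'}=\lambda r_u$, and the barycenter of $P$ relative to $u'$ is the same as the barycenter of $P$ relative to $u$.
   Context: For $k>0$ put $D_k=\pi/\sqrt{k}$; for $k\le 0$ put $D_k=\infty$. $M_k^2$ is the model surface of constant curvature $k$ (rescaled sphere, Euclidean plane, or rescaled hyperbolic plane). A geodesic metric space $X$ is $\mathrm{CAT}(k)$ if every geodesic triangle in $X$ of perimeter less than $2D_k$ has a comparison triangle in $M_k^2$ (same side lengths) such that distances between points of the triangle are at most the distances between the corresponding comparison points. For $u:P\to\mathbb{R}$ bounded, non-negative and not identically $0$, the baryradius is $r_u=\inf_{x\in X}\sup\{u(p)d(x,p)\mid p\in P\}$, and the barycenter of $P$ relative to $u$ is the point $q_u\in X$ (which exists and is unique) with $\sup\{u(p)d(q_u,p)\mid p\in P\}=r_u$. *)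

(* Defs.v *)
From HB Require Import structures.
From mathcomp Require Import all_boot all_order all_algebra.
From mathcomp Require Import all_classical all_reals all_analysis.

Set Implicit Arguments.
Unset Strict Implicit.
Unset Printing Implicit Defensive.

Import Order.TTheory GRing.Theory Num.Theory.
Import numFieldNormedType.Exports.

Local Open Scope classical_set_scope.
Local Open Scope ring_scope.

Definition model_diam (R : realType) (k : R) : \bar R :=
  if 0 < k then (pi / Num.sqrt k)%:E else +oo%E.

Definition dot3 (R : realType) (v w : 'rV[R]_3) : R :=
  v 0 0 * w 0 0 + v 0 1 * w 0 1 + v 0 2 * w 0 2.

Definition lorentz3 (R : realType) (v w : 'rV[R]_3) : R :=
  - (v 0 0 * w 0 0) + v 0 1 * w 0 1 + v 0 2 * w 0 2.

Definition arcosh (R : realType) (t : R) : R :=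
  ln (t + Num.sqrt (t ^+ 2 - 1)).

(* The model surface of constant curvature k, as a subset of R^3: the unit
   sphere if k > 0, the upper sheet of the hyperboloid if k < 0, and a
   coordinate plane if k = 0.  The curvature is set by rescaling the
   distance, not the set. *)
Definition model_set (R : realType) (k : R) : set 'rV[R]_3 :=
  if 0 < k then [set v | dot3 v v = 1]
  else if k < 0 then [set v | lorentz3 v v = -1 /\ 0 < v 0 0]
  else [set v | v 0 0 = 0].

Definition model_surface (R : realType) (k : R) : Type :=
  set_type (model_set k).

Definition model_dist (R : realType) (k : R) (x y : model_surface k) : R :=
  let v : 'rV[R]_3 := \val x in
  let w : 'rV[R]_3 := \val y in
  if 0 < k then acos (dot3 v w) / Num.sqrt k
  else if k < 0 then arcosh (- lorentz3 v w) / Num.sqrt (- k)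
  else Num.sqrt (dot3 (v - w) (v - w)).

(* The notions below take an arbitrary distance function d, so that they apply
   both to metric spaces (with mdist) and to the model surfaces. *)
Definition geodesic_segment (R : realType) (T : Type) (d : T -> T -> R)
    (x y : T) (S : set T) : Prop :=
  exists c : R -> T,
    [/\ c 0 = x, c (d x y) = y,
        {in `[0, d x y] &, forall s t, d (c s) (c t) = `|s - t|}
      & S = c @` `[0, d x y]].

Definition geodesic_space (R : realType) (T : Type) (d : T -> T -> R) : Prop :=
  forall x y : T, exists S : set T, geodesic_segment d x y S.

(* Vertices v 0, v 1, v 2; the side s i joins v i to v (i + 1 mod 3). *)
Definition geodesic_triangle (R : realType) (T : Type) (d : T -> T -> R)
    (v : 'I_3 -> T) (s : 'I_3 -> set T) : Prop :=
  forall i, geodesic_segment d (v i) (v (ordS i)) (s i).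

Definition perimeter (R : realType) (T : Type) (d : T -> T -> R)
    (v : 'I_3 -> T) : R :=
  \sum_i d (v i) (v (ordS i)).

(* The comparison point of p on the side s i is the p' on the side s' i at
   the same distance from the i-th vertex. *)
Definition CAT (R : realType) (k : R) (X : metricType R) : Prop :=
  geodesic_space (@mdist R X) /\
  forall (v : 'I_3 -> X) (s : 'I_3 -> set X),
    geodesic_triangle (@mdist R X) v s ->
    ((perimeter (@mdist R X) v)%:E < 2%:E * model_diam k)%E ->
    exists (v' : 'I_3 -> model_surface k) (s' : 'I_3 -> set (model_surface k)),
      [/\ geodesic_triangle (@model_dist R k) v' s',
          forall i, model_dist (v' i) (v' (ordS i)) = mdist (v i) (v (ordS i))
        & forall (i j : 'I_3) (p q : X) (p' q' : model_surface k),
            s i p -> s j q -> s' i p' -> s' j q' ->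
            model_dist (v' i) p' = mdist (v i) p ->
            model_dist (v' j) q' = mdist (v j) q ->
            mdist p q <= model_dist p' q'].

Definition metric_complete (R : realType) (X : metricType R) : Prop :=
  forall F : set_system X, ProperFilter F -> cauchy F -> exists x : X, F --> x.

Definition metric_bounded (R : realType) (X : metricType R) (P : set X) : Prop :=
  exists M : R, forall p q, P p -> P q -> mdist p q <= M.

Definition diameter (R : realType) (X : metricType R) (P : set X) : \bar R :=
  ereal_sup [set e | exists p q, [/\ P p, P q & e = (mdist p q)%:E]].

(* A weight on P is a total function u : X -> R; only its restriction to P
   matters. *)
Definition weighted_radius (R : realType) (X : metricType R) (P : set X)
    (u : X -> R) (x : X) : R :=
  sup [set u p * mdist x p | p in P].

Definition baryradius (R : realType) (X : metricType R) (P : set X)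
    (u : X -> R) : R :=
  inf [set weighted_radius P u x | x in [set: X]].

(* q is the barycenter: the one and only point realizing the baryradius. *)
Definition is_the_barycenter (R : realType) (X : metricType R) (P : set X)
    (u : X -> R) (q : X) : Prop :=
  unique (fun x => weighted_radius P u x = baryradius P u) q.

(* Main.v *)
Require Import Defs.
From HB Require Import structures.
From mathcomp Require Import all_boot all_order all_algebra.
From mathcomp Require Import all_classical all_reals all_analysis.
From mathcomp Require Import ring lra.

Set Implicit Arguments.
Unset Strict Implicit.
Unset Printing Implicit Defensive.

Import Order.TTheory GRing.Theory Num.Theory.
Import numFieldNormedType.Exports.

Local Open Scope classical_set_scope.
Local Open Scope ring_scope.

(** Scaling the weight by [lambda > 0] scales every weighted radius, hence also
    their infimum, by [lambda]; so the minimizers of the two weighted radii are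
    the same points.  This part is formal ([weighted_radiusZ], [baryradiusZ]).
    The content is that there is exactly one minimizer to begin with
    ([barycenter_exists]), and this is where curvature, completeness and the
    bound on the diameter enter.

    Write F for the weighted radius function and r for its infimum.  Existence
    and uniqueness both follow once the sets {F <= r + d} have diameter tending
    to 0 with d ([near_minimizers_shrink]): they then generate a Cauchy filter,
    its limit minimizes F because F is a supremum of continuous functions, and
    two minimizers lie in all of these sets.

    The sets shrink by the usual midpoint argument.  Suppose F x and F y are at
    most r + d while x and y are at least eps apart, and let m be the midpoint
    of a geodesic from x to y.  Uniformly over the points p that lie within rho
    of both x and y, where [2 * rho] is less than the model diameter, the
    distance from p to m is less than the larger of those from p to x and to y
    by a fixed kappa > 0 ([CAT_contraction]).  Since these distances are at most
    rho, this gains a fixed factor, F m <= (1 - kappa / rho) (r + d), which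
    contradicts the minimality of r when d is small.

    That near-minimizers are this close to P comes from a point p1 of P whose
    weight is almost the supremum of u ([near_minimizer_close]): the value of F
    at p1 is at most (sup u) (diam P), so F x close to r forces x to be within
    little more than diam P of p1, and within twice that of every point of P.
    A diameter less than a quarter of the model diameter is exactly what makes
    this radius smaller than half of it.

    The comparison axiom moves the midpoint estimate to the model surface, where
    it is read off from the length of a median:
    cos b + cos c = 2 cos (l / 2) cos d on the sphere, the same identity for
    cosh on the hyperboloid, and the parallelogram law in the plane.  In all
    three models it comes from writing the midpoint as a multiple of x + y. *)

(** * Medians in the model surfaces *)

Definition model_midpoint (R : realType) (k : R) (x y m : model_surface k) :
    Prop :=
  model_dist x m = model_dist x y / 2 /\ model_dist m y = model_dist x y / 2.

Lemma ler_of_sqr (R : realType) (a b : R) :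
  0 <= b -> a ^+ 2 <= b ^+ 2 -> a <= b.
Proof.
move=> b0 ab; case: (lerP a 0) => [/le_trans->//|a0].
by rewrite -(@ler_pXn2r _ 2)// nnegrE ltW.
Qed.

Lemma sum3_sqr_eq0 (R : realType) (a b c : R) :
  a ^+ 2 + b ^+ 2 + c ^+ 2 = 0 -> [/\ a = 0, b = 0 & c = 0].
Proof.
move=> /eqP; rewrite paddr_eq0 ?addr_ge0 ?sqr_ge0// paddr_eq0 ?sqr_ge0//.
by rewrite !sqrf_eq0 => /andP[/andP[/eqP-> /eqP->] /eqP->].
Qed.

(** The cosine is 1-Lipschitz: a gain in cosines is a gain in lengths. *)
Lemma cos_sub_le (R : realType) (a b : R) : a <= b -> cos a - cos b <= b - a.
Proof.
move=> ab.
have /(_ ab)[|c _ h] := @MVT_segment R cos (fun x => - sin x) a b.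
  by apply: continuous_subspaceT => x; exact: continuous_cos.
have := sin_le1 c; rewrite -opprB h mulNr opprK => s1.
by rewrite ler_piMl// subr_ge0.
Qed.

Section sphere.
Variables (R : realType) (k : R) (k_gt0 : 0 < k).
Let s := Num.sqrt k.
Let s_gt0 : 0 < s. Proof. by rewrite sqrtr_gt0. Qed.
Implicit Types x y m p : model_surface k.

Let normE x : dot3 (\val x) (\val x) = 1.
Proof. by case: x => v /= /set_mem; rewrite /model_set k_gt0. Qed.

Let dot_bound x y : -1 <= dot3 (\val x) (\val y) <= 1.
Proof.
have := normE x; have := normE y; rewrite /dot3.
move: (\val x 0 0) (\val x 0 1) (\val x 0 2) => a b c.
move: (\val y 0 0) (\val y 0 1) (\val y 0 2) => a' b' c' h h'.
have := sqr_ge0 (a - a'); have := sqr_ge0 (b - b').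
have := sqr_ge0 (c - c'); have := sqr_ge0 (a + a').
have := sqr_ge0 (b + b'); have := sqr_ge0 (c + c').
by move=> *; apply/andP; split; nra.
Qed.

Let distE x y : s * model_dist x y = acos (dot3 (\val x) (\val y)).
Proof. by rewrite /model_dist k_gt0 mulrC divfK// gt_eqF. Qed.

Lemma sphere_dist_range x y : 0 <= s * model_dist x y <= pi.
Proof. by rewrite distE acos_ge0 ?acos_lepi ?dot_bound. Qed.

Lemma sphere_cos_dist x y : cos (s * model_dist x y) = dot3 (\val x) (\val y).
Proof. by rewrite distE acosK// in_itv/= dot_bound. Qed.

(** The midpoint is [(x + y) / (2 * c)] with [c] the cosine of half the side:
    the three known products give [x + y - 2 * c * m] the square norm 0.  Pairing
    this zero vector with [p] gives the formula. *)
Lemma sphere_median x y m p : model_midpoint x y m ->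
  cos (s * model_dist p x) + cos (s * model_dist y p) =
  2 * cos (s * model_dist x y / 2) * cos (s * model_dist p m).
Proof.
move=> [xm my].
have := sphere_cos_dist x m; have := sphere_cos_dist m y.
have := sphere_cos_dist x y; rewrite xm my mulrA.
have -> : cos (s * model_dist x y) = 2 * cos (s * model_dist x y / 2) ^+ 2 - 1.
  rewrite {1}[s * _](_ : _ = (s * model_dist x y / 2) *+ 2).
    by rewrite cos_mulr2n mulr_natl.
  by rewrite -mulr_natr divfK.
set c := cos _ => xy my' xm'; rewrite !sphere_cos_dist.
move: xy my' xm'; have := normE x; have := normE y; have := normE m.
rewrite /dot3.
move: (\val x 0 0) (\val x 0 1) (\val x 0 2) => x0 x1 x2.
move: (\val y 0 0) (\val y 0 1) (\val y 0 2) => y0 y1 y2.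
move: (\val m 0 0) (\val m 0 1) (\val m 0 2) => m0 m1 m2.
move=> mm yy xx xy my' xm'.
have [] := @sum3_sqr_eq0 R (x0 + y0 - 2 * c * m0) (x1 + y1 - 2 * c * m1)
  (x2 + y2 - 2 * c * m2).
  have := congr1 ( *%R (4 * c ^+ 2)) mm.
  have := congr1 ( *%R c) my'; have := congr1 ( *%R c) xm'.
  by move=> /= *; lra.
move=> /(congr1 ( *%R (\val p 0 0))) h0 /(congr1 ( *%R (\val p 0 1))) h1.
by move=> /(congr1 ( *%R (\val p 0 2))) h2 /=; lra.
Qed.

End sphere.

Definition cosh (R : realType) (x : R) : R := (expR x + expR (- x)) / 2.

Lemma cosh2x (R : realType) (x : R) : cosh (x *+ 2) = 2 * cosh x ^+ 2 - 1.
Proof.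
have e : expR x * expR (- x) = 1 by rewrite -expRD subrr expR0.
rewrite /cosh mulr2n opprD !expRD; lra.
Qed.

Lemma cosh_arcosh (R : realType) (t : R) : 1 <= t -> cosh (arcosh t) = t.
Proof.
move=> t1; have t2 : 0 <= t ^+ 2 - 1 by nra.
rewrite /cosh /arcosh expRN.
have := sqr_sqrtr t2; have := sqrtr_ge0 (t ^+ 2 - 1).
set r := Num.sqrt _ => r0 rE.
have tr : 0 < t + r by lra.
rewrite lnK ?posrE//; apply: (mulIf (lt0r_neq0 tr)).
rewrite mulrAC mulrDl mulVf ?gt_eqF//; lra.
Qed.

Lemma lt_cosh (R : realType) (x : R) : 0 < x -> 1 < cosh x.
Proof.
move=> x0; have e : expR x * expR (- x) = 1 by rewrite -expRD subrr expR0.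
have : 1 < expR x by rewrite expR_gt1.
by rewrite /cosh; nra.
Qed.

(** The convexity bound [expR b - expR a <= expR b * (b - a)]; the other
    term of cosh, being decreasing, only helps. *)
Lemma cosh_sub_le (R : realType) (a b : R) :
  0 <= a <= b -> cosh b - cosh a <= expR b * (b - a).
Proof.
move=> /andP[a0 ab].
have e : expR b * expR (a - b) = expR a by rewrite -expRD; congr expR; ring.
have : expR (- b) <= expR (- a) by rewrite ler_expR lerN2.
have := expR_ge1Dx (a - b); have := expR_gt0 b.
by rewrite /cosh; nra.
Qed.

Lemma ler_cosh (R : realType) (a b : R) : 0 <= a <= b -> cosh a <= cosh b.
Proof.
move=> /andP[a0 ab].
have ea : expR a * expR (- a) = 1 by rewrite -expRD subrr expR0.
have eb : expR b * expR (- b) = 1 by rewrite -expRD subrr expR0.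
have : (expR b - expR a) * (1 - expR (- a) * expR (- b)) >= 0.
  apply: mulr_ge0; first by rewrite subr_ge0 ler_expR.
  by rewrite -expRD subr_ge0 expR_le1; lra.
have := congr1 ( *%R (expR (- b))) ea; have := congr1 ( *%R (expR (- a))) eb.
by rewrite /cosh /= => *; lra.
Qed.

(** The Lorentz form is positive definite on the orthogonal complement of a
    timelike vector, by the Cauchy-Schwarz inequality. *)
Lemma null_orthogonal_timelike (R : realType) (m0 m1 m2 w0 w1 w2 : R) :
  m0 ^+ 2 = 1 + m1 ^+ 2 + m2 ^+ 2 -> w0 * m0 = w1 * m1 + w2 * m2 ->
  w0 ^+ 2 = w1 ^+ 2 + w2 ^+ 2 -> [/\ w0 = 0, w1 = 0 & w2 = 0].
Proof.
move=> mE wm wE.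
(* Lagrange's identity turns the deficit in Cauchy-Schwarz into a square. *)
have e : w0 ^+ 2 + (w1 * m2 - w2 * m1) ^+ 2 = 0.
  have := congr1 (fun z => z ^+ 2) wm.
  have := congr1 ( *%R (w0 ^+ 2)) mE.
  have := congr1 ( *%R (m1 ^+ 2 + m2 ^+ 2)) wE.
  by move=> /= *; lra.
have w00 : w0 ^+ 2 = 0 by have := sqr_ge0 (w1 * m2 - w2 * m1); nra.
by apply: sum3_sqr_eq0; lra.
Qed.

Section hyperboloid.
Variables (R : realType) (k : R) (k_lt0 : k < 0).
Let s := Num.sqrt (- k).
Let s_gt0 : 0 < s. Proof. by rewrite sqrtr_gt0 oppr_gt0. Qed.
Implicit Types x y m p : model_surface k.

Let normE x : lorentz3 (\val x) (\val x) = -1 /\ 0 < \val x 0 0.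
Proof. by case: x => v /= /set_mem; rewrite /model_set k_lt0 lt_gtF. Qed.

Let lorentz_ge1 x y : 1 <= - lorentz3 (\val x) (\val y).
Proof.
have [] := normE x; have [] := normE y; rewrite /lorentz3.
move: (\val x 0 0) (\val x 0 1) (\val x 0 2) => a b c.
move: (\val y 0 0) (\val y 0 1) (\val y 0 2) => a' b' c' h a'0 h' a0.
have a1 : 1 <= a by nra.
have a'1 : 1 <= a' by nra.
suff : b * b' + c * c' <= a * a' - 1 by lra.
apply: ler_of_sqr; first by nra.
have bc : 0 <= (b * c' - b' * c) ^+ 2 by exact: sqr_ge0.
have aa : 0 <= (a - a') ^+ 2 by exact: sqr_ge0.
suff : (b * b' + c * c') ^+ 2 <= (a ^+ 2 - 1) * (a' ^+ 2 - 1) by lra.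
have -> : a ^+ 2 - 1 = b ^+ 2 + c ^+ 2 by lra.
have -> : a' ^+ 2 - 1 = b' ^+ 2 + c' ^+ 2 by lra.
lra.
Qed.

Lemma hyperboloid_cosh_dist x y :
  cosh (s * model_dist x y) = - lorentz3 (\val x) (\val y).
Proof.
rewrite /model_dist k_lt0 (lt_gtF k_lt0) mulrC divfK ?gt_eqF//.
exact/cosh_arcosh/lorentz_ge1.
Qed.

Lemma hyperboloid_dist_ge0 x y : 0 <= model_dist x y.
Proof.
rewrite /model_dist k_lt0 (lt_gtF k_lt0) divr_ge0 ?(ltW s_gt0)// ln_ge0//.
by rewrite (le_trans (lorentz_ge1 x y))// lerDl sqrtr_ge0.
Qed.

(** As on the sphere, [x + y - 2 * c * m] is null, but the Lorentz form being
    indefinite this does not suffice; the vector vanishes because it is also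
    orthogonal to the timelike vector [m]. *)
Lemma hyperboloid_median x y m p : model_midpoint x y m ->
  cosh (s * model_dist p x) + cosh (s * model_dist y p) =
  2 * cosh (s * model_dist x y / 2) * cosh (s * model_dist p m).
Proof.
move=> [xm my].
have := hyperboloid_cosh_dist x m; have := hyperboloid_cosh_dist m y.
have := hyperboloid_cosh_dist x y; rewrite xm my mulrA.
have -> : cosh (s * model_dist x y) =
    2 * cosh (s * model_dist x y / 2) ^+ 2 - 1.
  by rewrite -cosh2x; congr cosh; lra.
set c := cosh _ => xy my' xm'; rewrite !hyperboloid_cosh_dist.
move: xy my' xm'; have [+ _] := normE x; have [+ _] := normE y.
have [+ _] := normE m; rewrite /lorentz3.
move: (\val x 0 0) (\val x 0 1) (\val x 0 2) => x0 x1 x2.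
move: (\val y 0 0) (\val y 0 1) (\val y 0 2) => y0 y1 y2.
move: (\val m 0 0) (\val m 0 1) (\val m 0 2) => m0 m1 m2.
move=> mm yy xx xy my' xm'.
have [] := @null_orthogonal_timelike R m0 m1 m2 (x0 + y0 - 2 * c * m0)
  (x1 + y1 - 2 * c * m1) (x2 + y2 - 2 * c * m2).
- by lra.
- by have := congr1 ( *%R c) mm => /= *; lra.
- have := congr1 ( *%R (4 * c ^+ 2)) mm.
  have := congr1 ( *%R c) my'; have := congr1 ( *%R c) xm'.
  by move=> /= *; lra.
move=> /(congr1 ( *%R (\val p 0 0))) h0 /(congr1 ( *%R (\val p 0 1))) h1.
by move=> /(congr1 ( *%R (\val p 0 2))) h2 /=; lra.
Qed.

End hyperboloid.

Section plane.
Variables (R : realType).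
Implicit Types x y m p : model_surface (0 : R).

Lemma plane_dist_ge0 x y : 0 <= model_dist x y.
Proof. by rewrite /model_dist ltxx sqrtr_ge0. Qed.

Let dist_sqr x y : model_dist x y ^+ 2 = (\val x 0 0 - \val y 0 0) ^+ 2 +
  (\val x 0 1 - \val y 0 1) ^+ 2 + (\val x 0 2 - \val y 0 2) ^+ 2.
Proof.
rewrite /model_dist ltxx sqr_sqrtr /dot3 !mxE -?expr2//.
by rewrite !addr_ge0 ?sqr_ge0.
Qed.

(** The parallelogram law, once the equality case of the triangle inequality
    has identified [m] with [(x + y) / 2]. *)
Lemma plane_median x y m p : model_midpoint x y m ->
  model_dist p x ^+ 2 + model_dist y p ^+ 2 =
  2 * model_dist p m ^+ 2 + model_dist x y ^+ 2 / 2.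
Proof.
move=> [/(congr1 (fun z => z ^+ 2)) + /(congr1 (fun z => z ^+ 2))].
rewrite !expr_div_n !dist_sqr.
move: (\val x 0 0) (\val x 0 1) (\val x 0 2) => x0 x1 x2.
move: (\val y 0 0) (\val y 0 1) (\val y 0 2) => y0 y1 y2.
move: (\val m 0 0) (\val m 0 1) (\val m 0 2) => m0 m1 m2 xm my.
have [] := @sum3_sqr_eq0 R (x0 + y0 - 2 * m0) (x1 + y1 - 2 * m1)
  (x2 + y2 - 2 * m2); first by lra.
move: (\val p 0 0) (\val p 0 1) (\val p 0 2) => p0 p1 p2 h0 h1 h2.
have -> : y0 = 2 * m0 - x0 by lra.
have -> : y1 = 2 * m1 - x1 by lra.
have -> : y2 = 2 * m2 - x2 by lra.
lra.
Qed.

End plane.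

(** * Uniform contraction towards midpoints *)

(** For sides [b], [c] at most [t], the median formula gives
    [cos t <= cos d * cos (l / 2)], so [cos d] exceeds [cos t] by at least
    [cos d * (1 - cos (l / 2))], hence by [cos rho * (1 - cos (eps / 2))].  This
    is positive because [rho < pi / 2]. *)
Lemma spherical_median_contraction (R : realType) (b c l d t rho eps : R) :
  0 <= b <= t -> 0 <= c <= t -> t <= rho -> rho < pi / 2 ->
  0 < eps <= l -> l < pi -> 0 <= d <= pi ->
  cos b + cos c = 2 * cos (l / 2) * cos d ->
  d <= t - cos rho * (1 - cos (eps / 2)).
Proof.
move=> /andP[b0 bt] /andP[c0 ct] trho rhopi /andP[eps0 epsl] lpi /andP[d0 dpi].
have pi0 : 0 < pi :> R := pi_gt0 R.
have cosle (x y : R) : 0 <= x -> x <= y -> y <= pi -> cos y <= cos x.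
  move=> x0; rewrite le_eqVlt => /predU1P[->//|xy yp].
  by rewrite ltW// ltr_cos ?in_itv/=; lra.
have ce1 : cos (eps / 2) < 1.
  by rewrite -[ltRHS](@cos0 R) ltr_cos ?in_itv/=; lra.
have cr0 : 0 < cos rho by apply: cos_gt0_pihalf; lra.
have cl : cos (l / 2) <= cos (eps / 2) by apply: cosle; lra.
have cl0 : 0 < cos (l / 2) by apply: cos_gt0_pihalf; lra.
have cb : cos t <= cos b by apply: cosle; lra.
have cc : cos t <= cos c by apply: cosle; lra.
have ctr : cos rho <= cos t by apply: cosle; lra.
move=> medE.
have cd0 : 0 < cos d by rewrite -(pmulr_rgt0 _ cl0); lra.
have cdt : cos t + cos rho * (1 - cos (eps / 2)) <= cos d.
  have dl : cos d * cos (l / 2) <= cos d * cos (eps / 2) by rewrite ler_pM2l.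
  have de : cos d * cos (eps / 2) <= cos d by rewrite ler_piMr ?ltW.
  have : cos rho * (1 - cos (eps / 2)) <= cos d * (1 - cos (eps / 2)).
    by rewrite ler_pM2r ?subr_gt0//; lra.
  lra.
have dt : d <= t.
  have : cos t < cos d.
    by apply: lt_le_trans cdt; rewrite ltrDl mulr_gt0// subr_gt0.
  by rewrite ltr_cos ?in_itv/=; lra.
by have := cos_sub_le dt; lra.
Qed.

(** Here [cosh d * cosh (l / 2) <= cosh t], so [cosh d] lies below [cosh t] by at
    least [cosh (eps / 2) - 1]; the slope of cosh on the range considered is at
    most [expR rho]. *)
Lemma hyperbolic_median_contraction (R : realType) (b c l d t rho eps : R) :
  0 <= b <= t -> 0 <= c <= t -> t <= rho -> 0 < eps <= l -> 0 <= d ->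
  cosh b + cosh c = 2 * cosh (l / 2) * cosh d ->
  d <= t - (cosh (eps / 2) - 1) / expR rho.
Proof.
move=> /andP[b0 bt] /andP[c0 ct] trho /andP[eps0 epsl] d0.
have ce1 : 1 < cosh (eps / 2) by apply: lt_cosh; lra.
have cl : cosh (eps / 2) <= cosh (l / 2) by apply: ler_cosh; lra.
have cb : cosh b <= cosh t by apply: ler_cosh; lra.
have cc : cosh c <= cosh t by apply: ler_cosh; lra.
have cd1 : 1 <= cosh d.
  have -> : 1 = cosh 0 :> R by rewrite /cosh oppr0 expR0; lra.
  by apply: ler_cosh; rewrite lexx.
have cd_mono : t <= d -> cosh t <= cosh d by move=> td; apply: ler_cosh; lra.
have csub : d <= t -> cosh t - cosh d <= expR t * (t - d).
  by move=> dt; apply: cosh_sub_le; rewrite d0.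
move: (cosh b) (cosh c) (cosh d) (cosh t) (cosh (eps / 2)) (cosh (l / 2))
  ce1 cl cb cc cd1 cd_mono csub.
move=> B C D T E L ce1 cl cb cc cd1 cd_mono csub medE.
have dT : D + (E - 1) <= T by nra.
have dt : d <= t by rewrite leNgt; apply/negP => /ltW/cd_mono; lra.
have est : expR t <= expR rho by rewrite ler_expR.
rewrite lerBrDl -lerBrDr ler_pdivrMr ?expR_gt0// mulrC.
apply: (@le_trans _ _ (expR t * (t - d))); first by have := csub dt; lra.
by rewrite ler_wpM2r// subr_ge0.
Qed.

Lemma sphere_contraction (R : realType) (k rho eps : R) :
  0 < k -> Num.sqrt k * (2 * rho) < pi -> 0 < eps <= rho ->
  exists2 kappa, 0 < kappa & forall (p x y m : model_surface k) (t : R),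
    model_midpoint x y m -> model_dist p x <= t -> model_dist y p <= t ->
    t <= rho -> eps <= model_dist x y <= 2 * rho ->
    model_dist p m <= t - kappa.
Proof.
move=> k0 srho /andP[eps0 epsrho].
have s0 : 0 < Num.sqrt k by rewrite sqrtr_gt0.
have dle := sphere_dist_range k0; have med := @sphere_median _ _ k0.
move: (Num.sqrt k) s0 srho dle med => s s0 srho dle med.
have se0 : 0 < s * eps by rewrite mulr_gt0.
have ser : s * eps <= s * rho by rewrite ler_pM2l.
have pi0 : 0 < pi :> R := pi_gt0 R.
(* Lengths in the unit sphere are [s] times those of the model. *)
exists (cos (s * rho) * (1 - cos (s * eps / 2)) / s).
  rewrite divr_gt0// mulr_gt0//; first by apply: cos_gt0_pihalf; lra.
  by rewrite subr_gt0 -[ltRHS](@cos0 R) ltr_cos ?in_itv/=; lra.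
move=> p x y m t xym px yp trho /andP[exy xyr].
rewrite -(ler_pM2l s0) mulrBr mulrCA divff ?gt_eqF// mulr1.
have medE := med _ _ _ p xym.
apply: spherical_median_contraction medE; rewrite ?ler_pM2l//.
- by have /andP[-> _] := dle p x.
- by have /andP[-> _] := dle y p.
- lra.
- by rewrite se0.
- by apply: le_lt_trans srho; rewrite ler_pM2l.
Qed.

Lemma hyperboloid_contraction (R : realType) (k rho eps : R) :
  k < 0 -> 0 < eps ->
  exists2 kappa, 0 < kappa & forall (p x y m : model_surface k) (t : R),
    model_midpoint x y m -> model_dist p x <= t -> model_dist y p <= t ->
    t <= rho -> eps <= model_dist x y -> model_dist p m <= t - kappa.
Proof.
move=> k0 eps0.
have s0 : 0 < Num.sqrt (- k) by rewrite sqrtr_gt0 oppr_gt0.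
have dge0 := hyperboloid_dist_ge0 k0; have med := @hyperboloid_median _ _ k0.
move: (Num.sqrt (- k)) s0 med => s s0 med.
have sdge0 (x y : model_surface k) : 0 <= s * model_dist x y.
  by rewrite mulr_ge0 ?dge0 ?ltW.
have se0 : 0 < s * eps by rewrite mulr_gt0.
exists ((cosh (s * eps / 2) - 1) / expR (s * rho) / s).
  rewrite divr_gt0// divr_gt0 ?expR_gt0// subr_gt0 lt_cosh//; lra.
move=> p x y m t xym px yp trho exy.
rewrite -(ler_pM2l s0) mulrBr mulrCA divff ?gt_eqF// mulr1.
have medE := med _ _ _ p xym.
by apply: hyperbolic_median_contraction medE; rewrite ?sdge0 ?se0 /= ?ler_pM2l.
Qed.

Lemma plane_contraction (R : realType) (rho eps : R) :
  0 < eps <= rho ->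
  exists2 kappa, 0 < kappa & forall (p x y m : model_surface (0 : R)) (t : R),
    model_midpoint x y m -> model_dist p x <= t -> model_dist y p <= t ->
    t <= rho -> eps <= model_dist x y -> model_dist p m <= t - kappa.
Proof.
move=> /andP[eps0 epsrho]; have rho0 : 0 < rho by lra.
(* From [d ^+ 2 <= t ^+ 2 - eps ^+ 2 / 4], dividing by [t + d <= 2 * rho]. *)
exists (eps ^+ 2 / (8 * rho)); first by rewrite divr_gt0 ?exprn_gt0 ?mulr_gt0.
move=> p x y m t xym + + trho; have := plane_median p xym.
have := plane_dist_ge0 p x; have := plane_dist_ge0 y p.
have := plane_dist_ge0 p m.
move: (model_dist p x) (model_dist y p) (model_dist p m) (model_dist x y).
move=> b c d l d0 c0 b0 medE bt ct epsl.
suff : eps ^+ 2 <= (t - d) * (8 * rho).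
  by rewrite -ler_pdivrMr ?mulr_gt0//; lra.
have b2 : b ^+ 2 <= t ^+ 2 by rewrite ler_pXn2r ?nnegrE//; lra.
have c2 : c ^+ 2 <= t ^+ 2 by rewrite ler_pXn2r ?nnegrE//; lra.
have l2 : eps ^+ 2 <= l ^+ 2 by rewrite ler_pXn2r ?nnegrE//; lra.
have dt : d <= t by apply: ler_of_sqr; [lra|have := sqr_ge0 l; lra].
have : (t - d) * (t + d) <= (t - d) * (2 * rho).
  by rewrite ler_wpM2l ?subr_ge0//; lra.
lra.
Qed.

(** The three geometries enter the rest of the argument only through this
    estimate.  The gain [kappa] must not depend on [p], since a supremum over
    [p] will be taken. *)
Lemma model_contraction (R : realType) (k rho eps : R) :
  ((2 * rho)%:E < model_diam k)%E -> 0 < eps <= rho ->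
  exists2 kappa, 0 < kappa & forall (p x y m : model_surface k) (t : R),
    model_midpoint x y m -> model_dist p x <= t -> model_dist y p <= t ->
    t <= rho -> eps <= model_dist x y <= 2 * rho ->
    model_dist p m <= t - kappa.
Proof.
rewrite /model_diam; case: (ltrgtP 0 k) => [k0|k0|k0] hrho epsrho.
- apply: sphere_contraction => //.
  by rewrite mulrC -ltr_pdivlMr ?sqrtr_gt0.
- have /andP[eps0 _] := epsrho.
  have [kappa kappa0 h] := hyperboloid_contraction rho k0 eps0.
  by exists kappa => // p x y m t ? ? ? ? /andP[? _]; apply: (h p x y m t).
- subst k; have [kappa kappa0 h] := plane_contraction epsrho.
  by exists kappa => // p x y m t ? ? ? ? /andP[? _]; apply: (h p x y m t).
Qed.

(** * Transfer to CAT(k) spaces *)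

(** The point [m] is chosen before [p]: one midpoint of a fixed geodesic from [x]
    to [y] serves for all the triangles with apex [p]. *)
Lemma CAT_midpoint (R : realType) (k : R) (X : metricType R) :
  CAT k X -> forall x y : X, exists m : X, forall p : X,
  ((mdist p x + mdist x y + mdist y p)%:E < 2%:E * model_diam k)%E ->
  exists p' x' y' m' : model_surface k,
    [/\ model_midpoint x' y' m', model_dist p' x' = mdist p x,
        model_dist x' y' = mdist x y, model_dist y' p' = mdist y p
      & mdist p m <= model_dist p' m'].
Proof.
move=> [geoX catX] x y.
have [S1 xy] := geoX x y; have [c [c0 cL cd S1E]] := xy.
exists (c (mdist x y / 2)) => p per.
have [S0 px] := geoX p x; have [S2 yp] := geoX y p.
have := catX (fun i => nth p [:: p; x; y] i)
  (fun i => nth S0 [:: S0; S1; S2] i).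
case.
- by case=> [[|[|[|//]]] Hi].
- by rewrite /perimeter !big_ord_recl big_ord0 /= addr0 addrA.
move=> v' [s' [tri' len' cmp]].
pose i0 : 'I_3 := ord0; pose i1 : 'I_3 := lift ord0 ord0.
pose i2 : 'I_3 := lift ord0 (lift ord0 ord0).
have e01 : ordS i0 = i1 by apply/val_inj.
have e12 : ordS i1 = i2 by apply/val_inj.
have e20 : ordS i2 = i0 by apply/val_inj.
have [c' [c'0 c'L c'd s'E]] := tri' i1.
have [c'' [c''0 _ c''d s'0E]] := tri' i0.
have l01 := len' i0; have l12 := len' i1; have l20 := len' i2.
rewrite e01 /= in l01; rewrite e12 /= in l12 c'L c'd s'E; rewrite e20 /= in l20.
rewrite {}l12 in c'L c'd s'E *.
have L0 := mdist_ge0 x y.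
have in0 : (0 : R) \in `[0, mdist x y] by rewrite in_itv/= lexx.
have inL : mdist x y \in `[0, mdist x y] by rewrite in_itv/= lexx L0.
have inm : mdist x y / 2 \in `[0, mdist x y] by rewrite in_itv/=; lra.
have xm' : model_dist (v' i1) (c' (mdist x y / 2)) = mdist x y / 2.
  by rewrite -c'0 c'd// sub0r normrN ger0_norm// divr_ge0.
have m'y : model_dist (c' (mdist x y / 2)) (v' i2) = mdist x y / 2.
  by rewrite -c'L c'd// distrC ger0_norm; lra.
have xy' : model_dist (v' i1) (v' i2) = mdist x y.
  by rewrite -c'0 -c'L c'd// sub0r normrN ger0_norm.
exists (v' i0), (v' i1), (v' i2), (c' (mdist x y / 2)); split => //.
  by split; rewrite xy'.
apply: (cmp i0 i1) => //=.
- by case: px => g [g0 _ _ ->]; exists 0; rewrite //= in_itv/= lexx mdist_ge0.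
- by rewrite S1E; exists (mdist x y / 2).
- rewrite s'0E e01 l01; exists 0; rewrite //= in_itv/= lexx mdist_ge0//.
- by rewrite s'E; exists (mdist x y / 2).
- have z0 : 0 \in `[0, model_dist (v' i0) (v' (ordS i0))].
    by rewrite in_itv/= lexx e01 l01 mdist_ge0.
  by rewrite mdistxx -{1 2}c''0 c''d// subrr normr0.
- rewrite xm' -[X in mdist X (c _)]c0 cd// sub0r normrN ger0_norm// divr_ge0//.
Qed.

(** The triangles with apex [p] have perimeter at most [4 * rho], which the bound
    on [rho] keeps below twice the model diameter. *)
Lemma CAT_contraction (R : realType) (k rho eps : R) (X : metricType R) :
  CAT k X -> ((2 * rho)%:E < model_diam k)%E -> 0 < eps <= rho ->
  exists2 kappa, 0 < kappa & forall x y : X, eps <= mdist x y ->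
    exists m : X, forall (p : X) (t : R),
      mdist p x <= t -> mdist p y <= t -> t <= rho -> mdist p m <= t - kappa.
Proof.
move=> catX rhoD epsrho.
have [kappa kappa0 ctr] := model_contraction rhoD epsrho.
exists kappa => // x y exy; have [m hm] := CAT_midpoint catX x y.
exists m => p t px py trho.
have xyt : mdist x y <= 2 * t.
  by have := metric_triangle x p y; rewrite [mdist x p]metric_sym; lra.
have [|p' [x' [y' [m' [xym' px' xy' yp' pm]]]]] := hm p.
  move: rhoD; rewrite /model_diam [mdist y p]metric_sym.
  case: ifP => _; last by rewrite gt0_muley ?ltry.
  by rewrite -EFinM !lte_fin => ?; lra.
apply: le_trans pm _; apply: (ctr p' x' y' m' t) => //.
- by rewrite px'.
- by rewrite yp' metric_sym.
- by rewrite xy' exy; lra.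
Qed.

(** * Weighted radii *)

(** The conditions under which all the suprema and infima involved are taken over
    nonempty bounded sets; they are stable under scaling of the weight. *)
Definition bounded_weight (R : realType) (X : metricType R) (P : set X)
    (u : X -> R) : Prop :=
  [/\ P !=set0, metric_bounded P, forall p, P p -> 0 <= u p
    & exists M : R, forall p, P p -> u p <= M].

Section weighted_radius_theory.
Variables (R : realType) (X : metricType R) (P : set X) (u : X -> R).
Hypothesis uP : bounded_weight P u.

Lemma le_weighted_radius x p : P p -> u p * mdist x p <= weighted_radius P u x.
Proof.
move=> Pp; apply: ub_le_sup; last by exists p.
have [[p0 Pp0] [D PD] u0 [M uM]] := uP.
exists (M * (mdist x p0 + D)) => _ [q Pq <-].
apply: ler_pM (u0 _ Pq) (mdist_ge0 _ _) (uM _ Pq) _.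
by apply: le_trans (metric_triangle x p0 q) _; rewrite lerD2l PD.
Qed.

Lemma weighted_radius_le x a :
  (forall p, P p -> u p * mdist x p <= a) -> weighted_radius P u x <= a.
Proof.
have [[p0 Pp0] _ _ _] := uP => ha.
apply: ge_sup; first by exists (u p0 * mdist x p0), p0.
by move=> _ [p Pp <-]; exact: ha.
Qed.

Lemma weighted_radius_ge0 x : 0 <= weighted_radius P u x.
Proof.
have [[p0 Pp0] _ u0 _] := uP; apply: le_trans (le_weighted_radius x Pp0).
by rewrite mulr_ge0 ?u0 ?mdist_ge0.
Qed.

Lemma baryradius_le x : baryradius P u <= weighted_radius P u x.
Proof.
apply: ge_inf; last by exists x.
by exists 0 => _ [y _ <-]; exact: weighted_radius_ge0.
Qed.

Lemma le_baryradius a :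
  (forall x, a <= weighted_radius P u x) -> a <= baryradius P u.
Proof.
have [[p0 Pp0] _ _ _] := uP => ha.
apply: lb_le_inf; first by exists (weighted_radius P u p0), p0.
by move=> _ [x _ <-].
Qed.

Lemma baryradius_adherent e : 0 < e ->
  exists x, weighted_radius P u x < baryradius P u + e.
Proof.
have [[p0 Pp0] _ _ _] := uP => e0.
have [|_ [x _ <-] hx] := inf_adherent e0 (E := range (weighted_radius P u)).
  split; first by exists (weighted_radius P u p0), p0.
  by exists 0 => _ [y _ <-]; exact: weighted_radius_ge0.
by exists x.
Qed.

End weighted_radius_theory.

Lemma bounded_weightZ (R : realType) (X : metricType R) (P : set X) (u : X -> R)
  (lambda : R) : 0 <= lambda -> bounded_weight P u ->
  bounded_weight P (fun p => lambda * u p).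
Proof.
move=> l0 [P0 Pb u0 [M uM]]; split => //.
  by move=> p Pp; rewrite mulr_ge0 ?u0.
by exists (lambda * M) => p Pp; rewrite ler_wpM2l ?uM.
Qed.

Lemma weighted_radiusZ (R : realType) (X : metricType R) (P : set X)
  (u : X -> R) (lambda : R) (x : X) : 0 < lambda -> bounded_weight P u ->
  weighted_radius P (fun p => lambda * u p) x = lambda * weighted_radius P u x.
Proof.
move=> l0 uP; have luP := bounded_weightZ (ltW l0) uP.
apply/eqP; rewrite eq_le; apply/andP; split.
  apply: (weighted_radius_le luP) => p Pp.
  by rewrite -mulrA ler_pM2l// le_weighted_radius.
rewrite -ler_pdivlMl//; apply: (weighted_radius_le uP) => p Pp.
by rewrite ler_pdivlMl// mulrA; exact: (le_weighted_radius luP).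
Qed.

Lemma baryradiusZ (R : realType) (X : metricType R) (P : set X)
  (u : X -> R) (lambda : R) : 0 < lambda -> bounded_weight P u ->
  baryradius P (fun p => lambda * u p) = lambda * baryradius P u.
Proof.
move=> l0 uP; have luP := bounded_weightZ (ltW l0) uP.
apply/eqP; rewrite eq_le; apply/andP; split.
  rewrite -ler_pdivrMl//; apply: (le_baryradius uP) => x.
  by rewrite ler_pdivrMl// -weighted_radiusZ// baryradius_le.
apply: (le_baryradius luP) => x.
by rewrite weighted_radiusZ// ler_pM2l// baryradius_le.
Qed.

(** * Existence and uniqueness of the barycenter *)

(** Real numbers [delta < sigma] between the diameter of P and a quarter of the
    model diameter; the latter may be infinite, which is why finite values are
    extracted here. *)
Lemma diameter_slack (R : realType) (k : R) (X : metricType R) (P : set X) :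
  P !=set0 -> metric_bounded P ->
  (diameter P < model_diam k * (4^-1)%:E)%E ->
  exists delta sigma : R, [/\ 0 <= delta < sigma,
    ((4 * sigma)%:E < model_diam k)%E
    & forall p q, P p -> P q -> mdist p q <= delta].
Proof.
move=> [p0 Pp0] [M PM].
have diam_ge p q : P p -> P q -> ((mdist p q)%:E <= diameter P)%E.
  by move=> Pp Pq; apply: ereal_sup_ubound; exists p, q.
have M0 : 0 <= M by apply: le_trans (PM p0 p0 Pp0 Pp0); exact: mdist_ge0.
rewrite /model_diam; case: ifP => _ diamD; last first.
  by exists M, (M + 1); split; [rewrite M0; lra|exact: ltry|].
move: diamD diam_ge; rewrite -EFinM; case: (diameter P) => [d||] //.
- rewrite lte_fin => dD diam_ge.
  have d0 : 0 <= d.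
    apply: le_trans (mdist_ge0 p0 p0) _.
    by rewrite -lee_fin; exact: diam_ge.
  move: (pi / _) dD => D dD; exists d, ((d + D / 4) / 2).
  split; [by rewrite d0; lra|by rewrite lte_fin; lra|].
  by move=> p q Pp Pq; rewrite -lee_fin diam_ge.
- by move=> _ /(_ p0 p0 Pp0 Pp0); rewrite leeNy_eq.
Qed.

(** Near-minimizers stay close to P even though they range over the whole space:
    compare with the value at a point [p1] of P of almost maximal weight. *)
Lemma near_minimizer_close (R : realType) (X : metricType R) (P : set X)
    (u : X -> R) (delta sigma : R) :
  bounded_weight P u -> (exists2 p, P p & u p != 0) ->
  0 <= delta < sigma -> (forall p q, P p -> P q -> mdist p q <= delta) ->
  exists2 e, 0 < e & forall x, weighted_radius P u x <= baryradius P u + e ->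
    forall p, P p -> mdist p x <= 2 * sigma.
Proof.
move=> uP [p0 Pp0 up0] /andP[delta0 ds] Pdelta.
have [_ _ u0 [M uM]] := uP; pose s := sup (u @` P).
have hs : has_sup (u @` P).
  by split; [exists (u p0), p0|exists M => _ [p Pp <-]; exact: uM].
have us p : P p -> u p <= s by move=> Pp; apply: ub_le_sup hs.2 _ _; exists p.
have s0 : 0 < s.
  by apply: lt_le_trans (us _ Pp0); rewrite lt_neqAle eq_sym up0 u0.
have sigma0 : 0 < sigma by lra.
have [_ [p1 Pp1 <-] hp1] : exists2 z, (u @` P) z & s * (delta / sigma) < z.
  have : 0 < s - s * (delta / sigma).
    rewrite -{1}[s]mulr1 -mulrBr mulr_gt0// subr_gt0 ltr_pdivrMr//; lra.
  by move=> /sup_adherent/(_ hs); rewrite -/s opprB addrCA subrr addr0.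
have h1 : s * delta < u p1 * sigma by rewrite -ltr_pdivrMr// -mulrA.
have u1 : 0 < u p1 by apply: le_lt_trans hp1; rewrite mulr_ge0 ?divr_ge0; lra.
exists (u p1 * sigma - s * delta); first by rewrite subr_gt0.
have rs : baryradius P u <= s * delta.
  apply: le_trans (baryradius_le uP p1) _; apply: (weighted_radius_le uP).
  by move=> p Pp; apply: ler_pM; rewrite ?u0 ?mdist_ge0 ?us ?Pdelta.
move=> x hx p Pp.
have xp1 : mdist x p1 <= sigma.
  by rewrite -(ler_pM2l u1); have := le_weighted_radius uP x Pp1; lra.
have := metric_triangle p p1 x; rewrite [mdist p1 x]metric_sym.
by have := Pdelta _ _ Pp Pp1; lra.
Qed.

(** The midpoint argument.  Besides [kappa * r <= rho * d] it needs a positive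
    lower bound on [r + d], as [r] may be 0; the point [p1] of positive weight
    gives it, since one of [x], [y] is at least [eps / 2] away from [p1]. *)
Lemma near_minimizers_shrink (R : realType) (k : R) (X : metricType R)
    (P : set X) (u : X -> R) (e : R) :
  CAT k X -> (diameter P < model_diam k * (4^-1)%:E)%E ->
  bounded_weight P u -> (exists2 p, P p & u p != 0) -> 0 < e ->
  exists2 d, 0 < d & forall x y,
    weighted_radius P u x <= baryradius P u + d ->
    weighted_radius P u y <= baryradius P u + d -> mdist x y < e.
Proof.
move=> catX Pdiam uP u_neq0 e0.
have [P0 Pb u0 _] := uP; have [p1 Pp1 up1] := u_neq0.
have u1 : 0 < u p1 by rewrite lt_neqAle eq_sym up1 u0.
have [delta [sigma [ds sD Pdelta]]] := diameter_slack P0 Pb Pdiam.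
have [e1 e10 near] := near_minimizer_close uP u_neq0 ds Pdelta.
pose rho := 2 * sigma; have rho0 : 0 < rho by rewrite /rho; lra.
pose eps := Num.min e rho.
have eps0 : 0 < eps by rewrite lt_min e0.
have epse : eps <= e by rewrite ge_min lexx.
have epsrho : 0 < eps <= rho by rewrite eps0 ge_min lexx orbT.
have rhoD : ((2 * rho)%:E < model_diam k)%E by rewrite /rho mulrA -natrM.
have [kappa kappa0 ctr] := CAT_contraction catX rhoD epsrho.
(* The bounds [u p1 * eps <= 2 * (r + d)] and [kappa * r <= rho * d] yield
   [kappa * (u p1 * eps) <= 2 * (rho + kappa) * d], which [d0] violates. *)
pose d0 := kappa * (u p1 * eps) / (4 * (rho + kappa)).
have rk0 : 0 < 4 * (rho + kappa) by lra.
have d00 : 0 < d0 by rewrite divr_gt0// !mulr_gt0.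
exists (Num.min e1 d0); first by rewrite lt_min e10.
set d := Num.min _ _; set r := baryradius P u.
have de1 : d <= e1 by rewrite ge_min lexx.
have dd0 : d * (4 * (rho + kappa)) <= kappa * (u p1 * eps).
  by rewrite -ler_pdivlMr// ge_min lexx orbT.
move=> x y hx hy; rewrite ltNge; apply/negP => exy.
have [m hm] := ctr x y (le_trans epse exy).
have nx p : P p -> mdist p x <= rho by move=> Pp; apply: near => //; lra.
have ny p : P p -> mdist p y <= rho by move=> Pp; apply: near => //; lra.
pose t p := Num.max (mdist p x) (mdist p y).
have tx p : mdist p x <= t p by rewrite le_max lexx.
have ty p : mdist p y <= t p by rewrite le_max lexx orbT.
have trho p : P p -> t p <= rho by move=> Pp; rewrite ge_max nx ?ny.
have ut p : P p -> u p * t p <= r + d.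
  move=> Pp; have := le_weighted_radius uP x Pp.
  have := le_weighted_radius uP y Pp.
  rewrite ![mdist _ p]metric_sym /t; case: (leP (mdist p x)) => _; lra.
have pm p : P p -> mdist p m <= t p - kappa.
  by move=> Pp; apply: hm => //; exact: trho.
have kr : kappa <= rho.
  by have := pm _ Pp1; have := trho _ Pp1; have := mdist_ge0 p1 m; lra.
have rm : r <= (rho - kappa) * (r + d) / rho.
  apply: le_trans (baryradius_le uP m) _; apply: (weighted_radius_le uP).
  move=> p Pp; rewrite ler_pdivlMr// metric_sym.
  apply: (@le_trans _ _ (u p * ((rho - kappa) * t p))).
    rewrite -mulrA ler_wpM2l ?u0//.
    apply: (@le_trans _ _ ((t p - kappa) * rho)).
      by rewrite ler_pM2r// pm.
    have : kappa * t p <= kappa * rho by rewrite ler_pM2l// trho.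
    lra.
  by rewrite mulrCA ler_wpM2l ?ut ?subr_ge0.
have d_gt0 : 0 < d by rewrite lt_min e10.
have kd : 0 < kappa * d by rewrite mulr_gt0.
have rd : 0 < rho * d by rewrite mulr_gt0.
have rm' : kappa * r <= rho * d.
  by move: rm; rewrite ler_pdivlMr//; lra.
have xyt : eps <= 2 * t p1.
  have := metric_triangle x p1 y; rewrite [mdist x p1]metric_sym.
  by have := tx p1; have := ty p1; lra.
have : kappa * (u p1 * eps) <= kappa * (u p1 * (2 * t p1)).
  by rewrite !ler_pM2l.
have : kappa * (u p1 * t p1) <= kappa * (r + d) by rewrite ler_pM2l// ut.
lra.
Qed.

(** The near-minimizing sets generate a Cauchy filter whose limit is the
    barycenter. *)
Lemma barycenter_exists (R : realType) (k : R) (X : metricType R)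
    (P : set X) (u : X -> R) :
  metric_complete X -> CAT k X ->
  (diameter P < model_diam k * (4^-1)%:E)%E ->
  bounded_weight P u -> (exists2 p, P p & u p != 0) ->
  exists q, is_the_barycenter P u q.
Proof.
move=> complX catX Pdiam uP u_neq0.
have shrink e := near_minimizers_shrink (e := e) catX Pdiam uP u_neq0.
pose r := baryradius P u.
pose F := filter_from [set e : R | 0 < e]
  (fun e => [set x | weighted_radius P u x <= r + e]).
have FF : ProperFilter F.
  apply: filter_from_proper.
    apply: filter_from_filter; first by exists 1 => /=.
    move=> e1 e2 /= e10 e20; exists (Num.min e1 e2) => /=.
      by rewrite lt_min e10.
    move=> x /= hx; split; apply: le_trans hx _; rewrite lerD2l ge_min lexx//.
    by rewrite orbT.
  by move=> e /= e0; have [x /ltW hx] := baryradius_adherent uP e0; exists x.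
have Fcauchy : cauchy F.
  apply/cauchy_ballP => e e0; have [d d0 hd] := shrink _ e0.
  exists ([set x | weighted_radius P u x <= r + d],
          [set x | weighted_radius P u x <= r + d]).
    by split; exists d.
  by move=> [x y] /= [hx hy]; rewrite ballEmdist /=; exact: hd.
have [q Fq] := complX F FF Fcauchy.
have qr : weighted_radius P u q = r.
  apply/eqP; rewrite eq_le baryradius_le// andbT.
  apply: (weighted_radius_le uP) => p Pp; apply/ler_addgt0Pr => e e0.
  have up0 : 0 <= u p by have [_ _ ->] := uP.
  (* A near-minimizer [x] close to [q] costs [e'] in value and [u p * e'] in
     distance. *)
  pose e' := e / (1 + u p).
  have e'0 : 0 < e' by rewrite divr_gt0// ltr_pwDl.
  have [x [/= hx qx]] : exists x, weighted_radius P u x <= r + e' /\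
      mdist q x < e'.
    apply: (@filter_ex _ F); apply: filterI; first by exists e'.
    by have := Fq _ (nbhsx_ballx q e' e'0); rewrite ballEmdist.
  have := ler_wpM2l up0 (metric_triangle q x p).
  have := le_weighted_radius uP x Pp.
  have : u p * mdist q x <= u p * e' by rewrite ler_wpM2l// ltW.
  have : e' * (1 + u p) = e by rewrite divfK// gt_eqF// ltr_pwDl.
  lra.
exists q; split => // y yr; apply: mdist_positivity.
apply/eqP; rewrite eq_le mdist_ge0 andbT leNgt; apply/negP => qy.
have [d d0 hd] := shrink _ qy.
by have := hd q y; rewrite qr yr lerDl ltW// ltxx => /(_ isT isT).
Qed.

Theorem corollary1 (R : realType) (k : R) (X : metricType R)
    (X_complete : metric_complete X) (X_CAT : CAT k X)
    (P : set X) (P_bounded : metric_bounded P)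
    (P_diam : (diameter P < model_diam k * (4^-1)%:E)%E)
    (u : X -> R) (u_ge0 : forall p, P p -> 0 <= u p)
    (u_bounded : exists M : R, forall p, P p -> u p <= M)
    (u_neq0 : exists2 p, P p & u p != 0)
    (lambda : R) (lambda_gt0 : 0 < lambda) :
  let u' := fun p => lambda * u p in
  baryradius P u' = lambda * baryradius P u /\
  exists q : X, is_the_barycenter P u q /\ is_the_barycenter P u' q.
Proof.
have uP : bounded_weight P u.
  by split => //; have [p Pp _] := u_neq0; exists p.
move=> u'; split; first exact: baryradiusZ.
have [q qP] := barycenter_exists X_complete X_CAT P_diam uP u_neq0.
exists q; split => //.
have u'E x : (weighted_radius P u' x = baryradius P u') <->
    (weighted_radius P u x = baryradius P u).
  rewrite weighted_radiusZ// baryradiusZ//; split => [|->//].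
  exact: (mulfI (lt0r_neq0 lambda_gt0)).
by have [/u'E qE qU] := qP; split => // y /u'E; exact: qU.
Qed.
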